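(* Let $n\ge 1$ and let $S\subseteq[n]$ with $n\in S$, and write $r(S)=(r_1,\dots,r_{2m})$. Then for every positive integer $t$, $$i(\mathrm{SM}_n(S),t)=\sum_{(c_1,\dots,c_m)}\ \prod_{j=1}^m F(r_{2j-1},r_{2j},c_j,t),$$ where the sum ranges over all integer vectors $(c_1,\dots,c_m)\in\mathbb Z^m$ such that $c_1+\dots+c_m=0$ and, for every $1\le j\le m$, $-t v_j\le c_j\le t u_j$ and $c_1+\dots+c_j\ge 0$.
   Context: For $S,T\subseteq[n]$, write $T\le S$ if $|T|=|S|$ and, for each $1\le i\le |T|$, the $i$-th smallest element of $T$ is at most the $i$-th smallest element of $S$. The Schubert matroid $\mathrm{SM}_n(S)$ is the matroid on ground set $[n]=\{1,\dots,n\}$ whose bases are $\{T\subseteq[n]: T\le S\}$. For a matroid $M$ on $[n]$ with set of bases $\mathcal B$, its matroid polytope is $\mathcal P(M)=\mathrm{conv}\{e_B: B\in\mathcal B\}\subset\mathbb R^n$, where $e_B=\sum_{b\in B}e_b$ and $e_1,\dots,e_n$ is the standard basis; $i(M,t)$ denotes the number of lattice points $|t\mathcal P(M)\cap\mathbb Z^n|$ of the $t$-th dilate (this is a polynomial in $t$, the Ehrhart polynomial). For $S\subseteq[n]$ with $n\in S$, the indicator vector of $S$ can be written uniquely as $(0^{r_1},1^{r_2},0^{r_3},1^{r_4},\dots,0^{r_{2m-1}},1^{r_{2m}})$, where $x^p$ denotes $p$ consecutive copies of $x$, $r_1\ge0$ and $r_i>0$ for $i\ge2$; set $r(S)=(r_1,\dots,r_{2m})$.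 Given $r(S)=(r_1,\dots,r_{2m})$, define for $1\le i\le m$: $u_i=\min\{r_{2i-1},\sum_{j=i+1}^m r_{2j}\}$ and $v_i=\min\{r_{2i},\sum_{j=1}^{i-1}r_{2j-1}\}$ (empty sums are $0$). For integers $a,b\ge0$ with $a+b\ge1$, $c\in\mathbb Z$ and $t\ge0$, define $$F(a,b,c,t)=\sum_{j=0}^{a+b}(-1)^j\binom{a+b}{j}\binom{(t+1)(b-j)+a+c-1}{a+b-1},$$ with the conventions $\binom00=1$ and $\binom NK=0$ whenever $K<0$ or $N<K$ (for any integers $N,K$). *)

(* Defs.v *)
From HB Require Import structures.
From mathcomp Require Import all_boot all_order all_algebra.
From mathcomp Require Import reals.
Set Implicit Arguments. Unset Strict Implicit. Unset Printing Implicit Defensive.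
Import Order.TTheory GRing.Theory Num.Theory.

(* Ground set [n] = {1,...,n} is represented by 'I_n, element i standing for i+1.
   Since the order of 'I_n is the order of [n] shifted by one, comparisons of
   i-th smallest elements are unaffected. *)

Definition sorted_elems n (T : {set 'I_n}) : seq nat :=
  sort leq [seq val x | x <- enum T].

Definition gale_le n (T S : {set 'I_n}) : bool :=
  (#|T| == #|S|) &&
  all (fun i => nth 0 (sorted_elems T) i <= nth 0 (sorted_elems S) i) (iota 0 #|T|).

Definition schubert_bases n (S : {set 'I_n}) : {set {set 'I_n}} :=
  [set T | gale_le T S].

Definition in_dilated_matroid_polytope (R : realType) n
    (bases : {set {set 'I_n}}) (t : nat) (x : {ffun 'I_n -> int}) : Prop :=
  exists lam : {set 'I_n} -> R,
    (forall B, B \in bases -> 0 <= lam B)%R /\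
    (\sum_(B in bases) lam B = 1)%R /\
    (forall i : 'I_n,
        ((x i)%:~R = t%:R * \sum_(B in bases) lam B * (i \in B)%:R)%R).

Definition lattice_point_count (R : realType) n (bases : {set {set 'I_n}})
    (t : nat) (N : int) : Prop :=
  exists s : seq {ffun 'I_n -> int},
    uniq s /\
    (forall x, x \in s <-> in_dilated_matroid_polytope R bases t x) /\
    Posz (size s) = N.

Definition binz (N K : int) : int :=
  if (K < 0)%R then 0%R
  else if (N < K)%R then 0%R
  else Posz 'C(`|N|%N, `|K|%N).

Definition Ffun (a b : nat) (c : int) (t : nat) : int :=
  (\sum_(0 <= j < (a + b).+1)
     (-1) ^+ j * Posz 'C(a + b, j) *
     binz (((Posz (t.+1)) * (Posz b - Posz j)) + Posz a + c - 1) ((Posz (a + b)) - 1))%R.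

Definition intrange (lo hi : int) : seq int :=
  if (lo <= hi)%R then [seq (lo + Posz k)%R | k <- iota 0 (`|hi - lo|%N).+1] else [::].

Definition box (ps : seq (int * int)) : seq (seq int) :=
  foldr (fun p acc => [seq x :: v | x <- intrange p.1 p.2, v <- acc]) [:: [::]] ps.

(* Main.v *)
Require Import Defs.
From HB Require Import structures.
From mathcomp Require Import all_boot all_order all_algebra.
From mathcomp Require Import reals.
From mathcomp Require Import zify ring.
Import Order.TTheory GRing.Theory Num.Theory.

(* An integer point x lies in t P(SM_n(S)) iff 0 <= x_i <= t, every prefix sum
   X_i = x_1 + ... + x_i is at least t |S cap [i]|, and X_n = t |S|.  For the
   converse, x is the sum of the indicators of the t bases
     B_l = { i : floor((X_(i-1) + l)/t) < floor((X_i + l)/t) },  0 <= l < t.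
   Put h_i = X_i - t |S cap [i]|.  On a block 0^a 1^b of S the height h increases
   and then decreases, so nonnegativity of h only has to be checked at block ends,
   and the points that raise h by c along the block number F(a,b,c,t): they are the
   words of length a + b over {0,...,t} with sum t b + c, counted by
   inclusion-exclusion.  The bounds -t v_j <= c_j <= t u_j hold automatically. *)

(** * Bounded compositions by inclusion-exclusion *)

(* The number of weak compositions of [s] into [N] parts in [0, t], by inclusion-exclusion. *)
Definition compositions (t N : nat) (s : int) : int :=
  (\sum_(0 <= j < N.+1) (-1) ^+ j * Posz 'C(N, j) *
     binz (s - Posz (t.+1 * j) + Posz N - 1) (Posz N - 1))%R.

Lemma FfunE a b c t : Ffun a b c t = compositions t (a + b) (Posz (t * b) + c)%R.
Proof.
rewrite /Ffun /compositions; apply: eq_bigr => j _; congr (_ * binz _ _)%R.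
by rewrite !PoszM PoszD -addn1 PoszD; ring.
Qed.

(** Pascal's rule for [s >= 0]. For [s < 0] every upper index falls below its lower index, so all
    three terms vanish by convention. *)
Lemma binz_pascal (s : int) N : 0 < N ->
  (binz (s + Posz N.+1 - 1) (Posz N.+1 - 1) -
   binz (s - 1 + Posz N.+1 - 1) (Posz N.+1 - 1) =
   binz (s + Posz N - 1) (Posz N - 1))%R.
Proof.
case: N => // N _; rewrite /binz.
have -> : (Posz N.+2 - 1 = Posz N.+1)%R by lia.
have -> : (Posz N.+1 - 1 = Posz N)%R by lia.
rewrite /=; case: s => s.
  have -> : (Posz s + Posz N.+2 - 1 = Posz (s + N).+1)%R by lia.
  have -> : (Posz s - 1 + Posz N.+2 - 1 = Posz (s + N))%R by lia.
  have -> : (Posz s + Posz N.+1 - 1 = Posz (s + N))%R by lia.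
  rewrite !ltz_nat /=.
  rewrite ltnS !ltnNge leq_addl /= binS PoszD.
  case: leqP => h /=; last by ring.
  by rewrite bin_small //; ring.
by rewrite !ifT ?subrr //; lia.
Qed.

Lemma binz_telescope (s : int) N k : 0 < N ->
  (binz (s + Posz N.+1 - 1) (Posz N.+1 - 1) -
   binz (s - Posz k + Posz N.+1 - 1) (Posz N.+1 - 1) =
   \sum_(0 <= x < k) binz (s - Posz x + Posz N - 1) (Posz N - 1))%R.
Proof.
move=> N0; elim: k => [|k IH]; first by rewrite big_geq // subr0 subrr.
rewrite big_nat_recr //= -IH -(binz_pascal (s - Posz k)%R N) //.
have -> : (s - Posz k.+1 = s - Posz k - 1)%R by lia.
by ring.
Qed.

Lemma compositions1 t s : compositions t 1 s = ((0 <= s) && (s <= Posz t))%R.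
Proof.
rewrite /compositions !big_nat_recl // big_geq // /binz /= /bump /= !muln1 !muln0.
by rewrite !bin0 !bin1 expr0 expr1; do ?case: ifP; lia.
Qed.

(** Recursion on the value [x] of one part. It carries the counting meaning over to the alternating
    sum, together with [compositions1]. *)
Lemma compositionsS t N s : 0 < N ->
  compositions t N.+1 s =
  (\sum_(0 <= x < t.+1) compositions t N (s - Posz x))%R.
Proof.
move=> N0; rewrite /compositions exchange_big_nat /=.
(* Summing over [x] telescopes the [j]-th binomial to [G j - G j.+1], since a shift of [s] by [t.+1]
   raises [j] by one. Pascal's rule for ['C(N.+1, j.+1)] splits the left side in the same way. *)
pose G (j : nat) := binz (s - Posz (t.+1 * j) + Posz N.+1 - 1)%R (Posz N.+1 - 1)%R.
transitivity (\sum_(0 <= j < N.+1) (-1) ^+ j * Posz 'C(N, j) * (G j - G j.+1))%R; last first.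
  apply: eq_big_nat => j _; rewrite -mulr_sumr; congr (_ * _)%R.
  rewrite /G mulnS PoszD.
  have -> : (s - (Posz t.+1 + Posz (t.+1 * j)) = s - Posz (t.+1 * j) - Posz t.+1)%R by ring.
  rewrite binz_telescope //; apply: eq_bigr => x _; congr (binz _ _); ring.
rewrite -/(G _) big_nat_recl // bin0 -/(G 0).
under eq_bigr => j _ do rewrite binS PoszD -/(G j.+1) mulrDr mulrDl.
rewrite big_split /=.
under [in RHS]eq_bigr => j _ do rewrite mulrBr.
rewrite sumrB [in RHS]big_nat_recl // bin0.
rewrite [X in (_ + (X + _))%R]big_nat_recr //= bin_small // mulr0 mul0r addr0.
rewrite addrA; congr (_ + _)%R.
by rewrite -sumrN; apply: eq_bigr => j _; rewrite exprS; ring.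
Qed.

(** Invisible in the alternating sum, this follows by induction: if [s] lies outside [[0, t * N.+1]]
    and [0 <= x <= t], then [s - x] lies outside [[0, t * N]]. *)
Lemma compositions_support t N s : 0 < N ->
  ~~ ((0 <= s) && (s <= Posz (t * N)))%R -> compositions t N s = 0%R.
Proof.
case: N => // N _; elim: N s => [|N IH] s hs.
  by rewrite compositions1; move: hs; rewrite muln1; case: (_ && _).
rewrite compositionsS // big_nat big1 // => x /andP[_ hx]; apply: IH.
by move: hs; rewrite !mulnS; lia.
Qed.

(** * Iterated window sums *)

Definition window_sum (t : nat) (g : int -> int) (d : int) : int :=
  (\sum_(0 <= x < t.+1) g (d + Posz x))%R.

(** Iterating [N] times sums over all words of length [N] over {0,...,t}. Grouping the words by
    their total [e] gives the kernel [compositions t N]. *)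
Lemma iter_window_sum t N g d : 0 < N ->
  iter N (window_sum t) g d =
  (\sum_(0 <= e < (t * N).+1) compositions t N (Posz e) * g (d + Posz e))%R.
Proof.
case: N => // N _; elim: N d => [|N IH] d.
  rewrite muln1 /= /window_sum; apply: eq_big_nat => x /andP[_ hx].
  by rewrite compositions1 (_ : _ && _ = true) ?mul1r //; lia.
rewrite iterS {1}/window_sum.
under eq_bigr => x _ do rewrite IH.
under [in RHS]eq_bigr => e _ do rewrite compositionsS // mulr_suml.
rewrite [in RHS]exchange_big_nat /=; apply: eq_big_nat => x /andP[_ hx].
(* For a fixed letter [x], the terms with [e < x] or [e > x + t * N.+1] vanish by
   [compositions_support]; the rest is the inductive sum shifted by [x]. *)
rewrite [in RHS](@big_cat_nat _ _ _ x) //=; last by rewrite mulnS; lia.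
rewrite [X in _ = (X + _)%R]big1_seq ?add0r => [|e]; last first.
  rewrite mem_index_iota /= => he.
  by rewrite compositions_support ?mul0r //; lia.
rewrite [in RHS](@big_cat_nat _ _ _ (x + (t * N.+1).+1)) //=; try by rewrite mulnS; lia.
rewrite [X in _ = (_ + X)%R]big1_seq ?addr0 => [|e]; last first.
  rewrite mem_index_iota /= => /andP[he _].
  by rewrite compositions_support ?mul0r //; lia.
rewrite -[X in _ = \big[_/_]_(X <= _ < _) _]add0n big_addn addKn; apply: eq_bigr => e _.
by congr (compositions _ _ _ * g _)%R; lia.
Qed.

Lemma iter_window_sum_support t N (g : int -> int) (d : int) :
  (forall e, e < 0 -> g e = 0)%R -> (d + Posz (t * N) < 0)%R ->
  iter N (window_sum t) g d = 0%R.
Proof.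
move=> g0; elim: N d => [|N IH] d hd; first by rewrite /= g0 //; move: hd; lia.
rewrite iterS {1}/window_sum; apply: big1_seq => x; rewrite mem_index_iota /= => hx; apply: IH.
by move: hd; rewrite mulnS; lia.
Qed.

Lemma iter_window_sum_shift t N (g h : int -> int) k d :
  (forall e, g e = h (e + k))%R ->
  iter N (window_sum t) g d = iter N (window_sum t) h (d + k)%R.
Proof.
move=> gh; elim: N d => [|N IH] d; first exact: gh.
rewrite !iterS {1 3}/window_sum; apply: eq_bigr => x _.
by rewrite IH; congr (iter _ _ _ _); ring.
Qed.

(** * Nonnegative walks along a word of bits *)

(* Steps [x <= t] are taken from height [d], the letter [b] of [s] subtracting [t * b];
   the walk stays nonnegative and ends at 0. *)
Fixpoint walks (t : nat) (d : int) (s : seq bool) : seq (seq nat) :=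
  if (d < 0)%R then [::] else
  match s with
  | [::] => if d == 0%R then [:: [::]] else [::]
  | b :: s' => [seq x :: w | x <- iota 0 t.+1,
                             w <- walks t (d - Posz (t * b) + Posz x)%R s']
  end.

Lemma walks_lt0 t (d : int) s : (d < 0)%R -> walks t d s = [::].
Proof. by case: s => [|b s] /= ->. Qed.

Lemma walks_cons t (d : int) (b : bool) s : (0 <= d)%R ->
  walks t d (b :: s) =
  [seq x :: w | x <- iota 0 t.+1, w <- walks t (d - Posz (t * b) + Posz x)%R s].
Proof. by move=> hd; rewrite [LHS]/= ltNge hd. Qed.

Lemma mem_walks_cons t (d : int) (b : bool) s (w : seq nat) : (0 <= d)%R ->
  reflect (exists (x : nat) (v : seq nat),
             [/\ x <= t, v \in walks t (d - Posz (t * b) + Posz x)%R s & w = x :: v])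
          (w \in walks t d (b :: s)).
Proof.
move=> hd; rewrite walks_cons //.
by apply: (iffP allpairsPdep) => -[x [v [hx hv ->]]]; exists x, v; split=> //;
  move: hx; rewrite mem_iota.
Qed.

(** Unrolls the recursive height checks into prefix-sum inequalities, the form in which the polytope
    is described. At [i = 0] the inequality reads [0 <= d]. *)
Lemma mem_walks t (d : int) (s : seq bool) (w : seq nat) :
  w \in walks t d s <->
  [/\ size w = size s, all (fun x => x <= t) w,
      (forall i, Posz (t * count id (take i s)) <= d + Posz (sumn (take i w)))%R &
      (d + Posz (sumn w) = Posz (t * count id s))%R].
Proof.
elim: s d w => [|b s IH] d w.
  rewrite /=; case: ltP => hd.
    by split=> // -[] /size0nil -> _ /(_ 0) /=; lia.
  case: eqP => [->|hd0]; last by split=> // -[] /size0nil -> _ _ /=; lia.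
  rewrite inE; split=> [/eqP ->|[/size0nil -> //]].
  by split=> [||i|] /=; rewrite ?muln0.
case: (ltP d 0%R) => hd.
  by rewrite walks_lt0 //; split=> // -[_ _ /(_ 0)]; rewrite !take0 /=; lia.
split.
  case/mem_walks_cons => // x [v [hx /IH [sz al pre tot] ->]].
  split => /=; first by rewrite sz.
  - by rewrite hx.
  - case=> [|i] /=; first by move: hd; lia.
    by have := pre i; rewrite mulnDr; lia.
  - by move: tot; rewrite mulnDr; lia.
case: w => [|x w] [] //= [sz] /andP[hx al] pre tot.
apply/mem_walks_cons => //; exists x, w; split=> //; apply/IH.
split=> // [i|]; last by move: tot; rewrite mulnDr; lia.
by have := pre i.+1; rewrite /= mulnDr; lia.
Qed.

Lemma walks_uniq t (d : int) s : uniq (walks t d s).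
Proof.
elim: s d => [|b s IH] d; first by rewrite /=; case: ifP => // _; case: ifP.
case: (ltP d 0%R) => hd; first by rewrite walks_lt0.
rewrite walks_cons //.
apply: allpairs_uniq_dep => [|x _|]; [exact: iota_uniq | exact: IH |].
by case=> x w [y z] _ _ /= [-> ->].
Qed.

Definition nwalks (t : nat) (s : seq bool) (d : int) : int := Posz (size (walks t d s)).

Lemma nwalks_lt0 t s (d : int) : (d < 0)%R -> nwalks t s d = 0%R.
Proof. by move=> hd; rewrite /nwalks walks_lt0. Qed.

Lemma nwalks_nil t d : nwalks t [::] d = Posz (d == 0%R).
Proof. by rewrite /nwalks /=; case: ltP => // hd; case: eqP => //; move: hd; lia. Qed.

Lemma nwalks_cons t (b : bool) s (d : int) : (0 <= d)%R ->
  nwalks t (b :: s) d = window_sum t (nwalks t s) (d - Posz (t * b))%R.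
Proof.
move=> hd; rewrite /nwalks walks_cons // size_allpairs_dep sumnE big_map.
by rewrite (big_morph Posz PoszD (erefl _)) /window_sum /index_iota subn0.
Qed.

Lemma nwalks_ones t b s d :
  nwalks t (nseq b true ++ s) d = iter b (window_sum t) (nwalks t s) (d - Posz (t * b))%R.
Proof.
elim: b d => [|b IH] d; first by rewrite muln0 subr0.
case: (ltP d 0%R) => hd.
  (* Even [b] letters equal to [t] only bring [d - t * b] back to [d < 0], so both sides are 0. *)
  rewrite nwalks_lt0 // iter_window_sum_support //; first exact: nwalks_lt0.
  by move: hd; lia.
rewrite nwalks_cons // iterS {1 2}/window_sum; apply: eq_bigr => x _.
by rewrite IH; congr (iter _ _ _ _); rewrite mulnS; lia.
Qed.

(** Along a run of zeros the height never decreases, so [0 <= d] settles all checks within the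
    run. *)
Lemma nwalks_zeros t a s (d : int) : (0 <= d)%R ->
  nwalks t (nseq a false ++ s) d = iter a (window_sum t) (nwalks t s) d.
Proof.
elim: a d => [|a IH] d hd //.
rewrite nwalks_cons // iterS {1 2}/window_sum; apply: eq_bigr => x _.
by rewrite muln0 subr0 IH //; move: hd; lia.
Qed.

(** * Decomposition into blocks *)

Lemma sum_intrange (lo hi : int) n (f : int -> int) : (hi - lo = Posz n)%R ->
  (\sum_(c <- intrange lo hi) f c = \sum_(0 <= e < n.+1) f (lo + Posz e))%R.
Proof.
move=> h; rewrite /intrange (_ : (lo <= hi)%R = true); last by lia.
by rewrite big_map /index_iota subn0 (_ : `|hi - lo|%N = n) // h.
Qed.

(** The two runs merge into [a + b] window sums started at [d - t * b]. A word of total [e] raises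
    the height by [c = e - t * b], which runs from [- t * b] to [t * a]. *)
Lemma nwalks_block t a b s (d : int) : 0 < b -> (0 <= d)%R ->
  (nwalks t (nseq a false ++ nseq b true ++ s) d =
   \sum_(c <- intrange (- Posz (t * b)) (Posz (t * a)))
      Ffun a b c t * nwalks t s (d + c))%R.
Proof.
move=> b0 hd; rewrite nwalks_zeros // (iter_window_sum_shift _ _ _ _ _ _ (nwalks_ones t b s)).
rewrite -iterD iter_window_sum; last by lia.
rewrite (sum_intrange _ _ (t * (a + b))); last by rewrite mulnDr; lia.
apply: eq_bigr => e _; rewrite FfunE; congr (compositions _ _ _ * nwalks _ _ _)%R; ring.
Qed.

Lemma mem_intrange lo hi x : (x \in intrange lo hi) = (lo <= x <= hi)%R.
Proof.
rewrite /intrange; case: ifP => h; last by rewrite in_nil; move: h; lia.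
apply/mapP/idP => [[k]|hx].
  by rewrite mem_iota => hk ->; move: h; lia.
by exists `|x - lo|%N; rewrite ?mem_iota; lia.
Qed.

Lemma intrange_uniq lo hi : uniq (intrange lo hi).
Proof.
rewrite /intrange; case: ifP => // _.
by rewrite map_inj_uniq ?iota_uniq // => x y /addrI [].
Qed.

Lemma box_uniq ps : uniq (box ps).
Proof.
elim: ps => //= p ps IH; apply: allpairs_uniq => //; first exact: intrange_uniq.
by case=> x v [y w] _ _ /= [-> ->].
Qed.

Lemma mem_box ps c :
  c \in box ps <->
  size c = size ps /\
  forall j, j < size ps ->
    ((nth (0, 0) ps j).1 <= nth 0 c j <= (nth (0, 0) ps j).2)%R.
Proof.
elim: ps c => [|p ps IH] c /=.
  by rewrite inE; split=> [/eqP -> //|[/size0nil ->]].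
split.
  case/allpairsP => -[x v] [/=]; rewrite mem_intrange => hx /IH[sz hv] ->.
  by split=> [/=|[|j] //=]; [rewrite sz | exact: hv].
case: c => [|x v] [] //= [sz] hv; apply/allpairsP; exists (x, v); split=> //=.
  by rewrite mem_intrange; exact: (hv 0).
by apply/IH; split=> // j; exact: (hv j.+1).
Qed.

Definition block_bits (L : seq (nat * nat)) : seq bool :=
  flatten [seq nseq p.1 false ++ nseq p.2 true | p <- L].

(** [d] is the height before the first block and [c] lists the rises of the blocks, so only heights
    at block ends are tested. *)
Fixpoint admissible (d : int) (c : seq int) : bool :=
  (0 <= d)%R && (if c is x :: c' then admissible (d + x) c' else d == 0%R).

Lemma nwalks_block_bits t L d : all (fun p => 0 < p.2) L ->
  (nwalks t (block_bits L) d =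
   \sum_(c <- box [seq (- Posz (t * p.2), Posz (t * p.1)) | p <- L] | admissible d c)
     \prod_(i <- zip L c) Ffun i.1.1 i.1.2 i.2 t)%R.
Proof.
elim: L d => [|[a b] L IH] d /=.
  move=> _; rewrite big_cons !big_nil addr0 nwalks_nil /=.
  by case: eqP => [-> //|]; case: (0 <= d)%R.
case/andP => b0 L0; case: (ltP d 0%R) => hd.
  by rewrite nwalks_lt0 // big1 // => -[|x c] /=; rewrite leNgt hd.
rewrite /block_bits /= -catA -/(block_bits L) nwalks_block //.
rewrite [RHS]big_mkcond big_allpairs_dep /=.
apply: eq_bigr => x _; rewrite IH // -big_mkcond /= hd /= mulr_sumr.
by apply: eq_bigr => c _; rewrite big_cons.
Qed.

Lemma flatten_runs (r : nat -> nat) m :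
  flatten [seq nseq (r k) (~~ odd k) | k <- iota 1 (2 * m)] =
  block_bits [seq (r (2 * j).+1, r (2 * j.+1)) | j <- iota 0 m].
Proof.
elim: m => // m IH.
have -> : 2 * m.+1 = 2 * m + 2 by lia.
rewrite iotaD map_cat flatten_cat IH /block_bits.
have -> : iota 0 m.+1 = iota 0 m ++ [:: m] by rewrite -addn1 iotaD.
rewrite !map_cat flatten_cat /= !cats0; congr (_ ++ _).
have -> : 2 * m.+1 = (2 * m).+2 by lia.
by rewrite add1n /= oddM.
Qed.

(** * Admissible height vectors and the bounds u, v *)

Lemma admissibleP (d : int) (c : seq int) :
  reflect ((forall j, 0 <= d + \sum_(x <- take j c) x) /\ d + \sum_(x <- c) x = 0)%R
    (admissible d c).
Proof.
elim: c d => [|x c IH] d /=.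
  rewrite big_nil addr0; apply: (iffP andP) => [[hd /eqP d0]|[h /eqP d0]].
    by split=> // _; exact: hd.
  by split=> //; exact: (h 0).
rewrite big_cons addrA; apply: (iffP andP) => [[hd /IH[h e]]|[h e]].
  by split=> // -[|j] /=; rewrite ?big_nil ?addr0 // big_cons addrA.
split; first by have := h 0; rewrite /= big_nil addr0.
by apply/IH; split=> // j; have := h j.+1; rewrite /= big_cons addrA.
Qed.

Lemma sum_take (c : seq int) j :
  (\sum_(x <- take j c) x = \sum_(0 <= i < j) nth 0 c i)%R.
Proof.
elim: c j => [|x c IH] [|j]; rewrite ?big_nil ?(big_geq (leqnn 0)) //.
  by rewrite big1 // => i _; rewrite nth_nil.
by rewrite /= big_cons big_nat_recl // IH.
Qed.

Lemma sum_le_mul (t : nat) (f : nat -> int) (g : nat -> nat) (p q : nat) :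
  (forall i, (p <= i < q)%N -> f i <= Posz (t * g i))%R ->
  (\sum_(p <= i < q) f i <= Posz (t * \sum_(p <= i < q) g i))%R.
Proof.
by move=> h; rewrite big_distrr /= (big_morph Posz PoszD (erefl _)); apply: ler_sum_nat.
Qed.

(** Let H be the height before block [k]. Then [c_k >= -H], and H is at most [t] times the sum of
    the earlier [a j]. Also [c_k <= H + c_k], which is minus the sum of the later rises because the
    total is 0, hence at most [t] times the sum of the later [b j]. *)
Lemma admissible_bounds (t m : nat) (a b : nat -> nat) (c : seq int) :
  size c = m -> admissible 0 c ->
  (forall k, (k < m)%N -> - Posz (t * b k) <= nth 0 c k <= Posz (t * a k))%R ->
  forall k, k < m ->
    (- Posz (t * minn (b k) (\sum_(0 <= j < k) a j)) <= nth 0 c k <=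
     Posz (t * minn (a k) (\sum_(k.+1 <= j < m) b j)))%R.
Proof.
move=> sz /admissibleP[pre tot] hc k km.
have hlo : (\sum_(0 <= i < k) nth 0 c i <= Posz (t * \sum_(0 <= i < k) a i))%R.
  apply: sum_le_mul => i /andP[_ ik].
  by have /andP[] := hc i (ltn_trans ik km).
have hhi : (\sum_(k.+1 <= i < m) - nth 0 c i <= Posz (t * \sum_(k.+1 <= i < m) b i))%R.
  apply: sum_le_mul => i /andP[_ im].
  by have /andP[] := hc i im; lia.
have hk := pre k; have hk1 := pre k.+1.
move: tot; rewrite -[c in (\sum_(_ <- c) _)%R](take_size) !sum_take sz.
rewrite (@big_cat_nat _ _ _ k.+1) //=.
move: hk hk1 hhi; rewrite !sum_take !add0r sumrN big_nat_recr //= => hk hk1 hhi tot.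
have /andP[] := hc k km.
move: (\sum_(0 <= j < k) nth 0 c j)%R (\sum_(k.+1 <= j < m) nth 0 c j)%R (nth 0 c k)%R
  hlo hk hk1 hhi tot => x y z.
rewrite !minnMr; move: (t * _) (t * _) (t * _) (t * _) => p q p' q'.
lia.
Qed.

Lemma big_box_restrict (P Q : seq (int * int)) (A B : pred (seq int)) (F : seq int -> int) :
  (forall c, c \in box P -> A c -> c \in box Q /\ B c) ->
  (forall c, c \in box Q -> B c -> c \in box P /\ A c) ->
  (\sum_(c <- box P | A c) F c = \sum_(c <- box Q | B c) F c)%R.
Proof.
move=> PQ QP; rewrite -!(big_filter (box _)); apply: perm_big.
apply: uniq_perm; rewrite ?filter_uniq ?box_uniq // => c; rewrite !mem_filter.
by apply/andP/andP => -[h hc]; [have [] := PQ c hc h | have [] := QP c hc h].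
Qed.

Lemma schubert_sum_nwalks t m (r : nat -> nat) :
  (forall k, 2 <= k <= 2 * m -> 0 < r k) ->
  let u := fun i => minn (r (2 * i - 1)) (\sum_(i + 1 <= j < m + 1) r (2 * j)) in
  let v := fun i => minn (r (2 * i)) (\sum_(1 <= j < i) r (2 * j - 1)) in
  (\sum_(c <- box [seq ((- Posz (t * v j))%R, Posz (t * u j)) | j <- iota 1 m]
         | (\sum_(x <- c) x == 0)%R &&
           all (fun j => (0 <= \sum_(x <- take j c) x)%R) (iota 1 m))
     \prod_(j < m) Ffun (r (2 * j).+1)%N (r (2 * j.+1))%N (nth 0%R c j) t)%R =
  nwalks t (flatten [seq nseq (r k) (~~ odd k) | k <- iota 1 (2 * m)]) 0.
Proof.
move=> rpos u v; rewrite flatten_runs nwalks_block_bits; last first.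
  apply/allP => p /mapP[j]; rewrite mem_iota => hj ->{p} /=; apply: rpos; lia.
set L := [seq (r _, r _) | j <- iota 0 m].
(* [P] holds the full ranges of the block rises, [Q] the narrower ranges given by [u] and [v]; both
   boxes contain the same admissible vectors. *)
set P := [seq (- Posz (t * p.2), Posz (t * p.1))%R | p <- L].
set Q := [seq _ | j <- iota 1 m].
have szL : size L = m by rewrite size_map size_iota.
have nthL k : k < m -> nth (0, 0) L k = (r (2 * k).+1, r (2 * k.+1)).
  by move=> km; rewrite (nth_map 0) ?size_iota // nth_iota.
have nthP k : k < m ->
    nth (0%R, 0%R) P k = (- Posz (t * r (2 * k.+1)), Posz (t * r (2 * k).+1))%R.
  by move=> km; rewrite (nth_map (0, 0)) ?szL // nthL.
have nthQ k : k < m -> nth (0%R, 0%R) Q k =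
    (- Posz (t * minn (r (2 * k.+1)) (\sum_(0 <= j < k) r (2 * j).+1)),
     Posz (t * minn (r (2 * k).+1) (\sum_(k.+1 <= j < m) r (2 * j.+1))))%R.
  move=> km; rewrite (nth_map 0) ?size_iota // nth_iota // add1n /u /v.
  have pred2 j : 2 * j.+1 - 1 = (2 * j).+1 by lia.
  rewrite !addn1 !big_add1 /= pred2.
  by under eq_bigr => j _ do rewrite pred2.
rewrite (big_box_restrict Q P _ (admissible 0)).
- rewrite big_seq_cond [RHS]big_seq_cond; apply: eq_bigr => c /andP[/mem_box[sz _] _].
  move: sz; rewrite size_map szL => sz.
  rewrite (big_nth ((0, 0), 0%R)) size_zip szL sz minnn big_mkord.
  by apply: eq_bigr => j _; rewrite nth_zip ?szL // nthL.
- move=> c /mem_box[]; rewrite size_map size_iota => sz hc /andP[/eqP tot /allP pre].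
  split.
    apply/mem_box; rewrite size_map szL; split=> // k km.
    have := hc k km; rewrite nthQ // nthP //= => /andP[h1 h2].
    by move: h1 h2; rewrite !minnMr; lia.
  apply/admissibleP; rewrite add0r; split=> // j; rewrite add0r.
  (* Prefix lengths outside [1..m] give the empty sum or the total, both 0. *)
  case: (posnP j) => [->|j0]; first by rewrite take0 big_nil.
  case: (leqP j m) => jm; first by apply: pre; rewrite mem_iota; lia.
  by rewrite take_oversize ?tot // sz ltnW.
- move=> c /mem_box[]; rewrite size_map szL => sz hc adm; split.
    apply/mem_box; rewrite size_map size_iota; split=> // k km; rewrite nthQ //.
    apply: (admissible_bounds t m (fun k => r (2 * k).+1) (fun k => r (2 * k.+1))) => //.
    by move=> j jm; have := hc j jm; rewrite nthP.
  case/admissibleP: adm => pre tot; move: tot; rewrite add0r => ->; rewrite eqxx /=.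
  by apply/allP => j _; have := pre j; rewrite add0r.
Qed.

(** * Prefix sums and the Gale order *)

Definition psum (n : nat) (f : 'I_n -> nat) (i : nat) : nat := \sum_(j < n | j < i) f j.

(** With ordinals starting at 0, [rk B i] is the size of B cap [i]. *)
Local Notation rk B := (psum _ (fun j => nat_of_bool (j \in B))).

Lemma psum0 n (f : 'I_n -> nat) : psum n f 0 = 0.
Proof. by apply: big1. Qed.

Lemma psum_succ n (f : 'I_n -> nat) (i : 'I_n) : psum n f i.+1 = psum n f i + f i.
Proof.
rewrite /psum (bigD1 i) /= ?leqnn // addnC; congr (_ + _).
by apply: eq_bigl => j; rewrite ltnS ltn_neqAle andbC.
Qed.

Lemma psum_oversize n (f : 'I_n -> nat) i : n <= i -> psum n f i = \sum_(j < n) f j.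
Proof. by move=> ni; apply: eq_bigl => j; rewrite (leq_trans _ ni). Qed.

Lemma sumn_take_enum n (f : 'I_n -> nat) i :
  sumn (take i [seq f j | j <- enum 'I_n]) = psum n f i.
Proof.
have sz : size [seq f j | j <- enum 'I_n] = n by rewrite size_map size_enum_ord.
case: (leqP n i) => [ni|].
  by rewrite take_oversize ?sz // psum_oversize // sumnE big_map big_enum.
elim: i => [|i IH] ni; first by rewrite take0 psum0.
have {}ni := ltnW ni; rewrite (take_nth 0) ?sz // sumn_rcons IH //.
rewrite (psum_succ n f (Ordinal ni)) (nth_map (Ordinal ni)) ?size_enum_ord //.
by congr (_ + f _); apply: val_inj; rewrite /= nth_enum_ord.
Qed.

Lemma count_take_enum n (S : {set 'I_n}) i :
  count id (take i [seq j \in S | j <- enum 'I_n]) = rk S i.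
Proof. by rewrite -sumn_count map_take -map_comp sumn_take_enum. Qed.

Lemma count_sorted_elems n (S : {set 'I_n}) i :
  count (fun x => x < i) (sorted_elems S) = rk S i.
Proof.
rewrite /sorted_elems count_sort count_map /psum -big_mkcondl -sum1_count big_enum_cond.
by apply: eq_bigl => j; rewrite andbC.
Qed.

(** Translates between order statistics, which define the Gale order, and prefix counts, which are
    linear in the indicator vector. *)
Lemma nth_lt_count (s : seq nat) k i : sorted leq s -> k < size s ->
  (nth 0 s k < i) = (k < count (fun x => x < i) s).
Proof.
elim: s k => // x s IH k /= ps ks.
have ss := path_sorted ps.
have /allP xmin := order_path_min leq_trans ps.
case: (ltnP x i) => xi.
  by case: k ks => [|k] //= ks; rewrite IH.
have -> : count (fun x => x < i) s = 0.
  by apply/eqP; rewrite -leqn0 leqNgt -has_count; apply/hasPn => y /xmin; lia.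
rewrite ltn0; apply/negbTE; rewrite -leqNgt (leq_trans xi) //.
by case: k ks => [|k] //= ks; apply/xmin/mem_nth.
Qed.

Lemma size_sorted_elems n (S : {set 'I_n}) : size (sorted_elems S) = #|S|.
Proof. by rewrite size_sort size_map cardE. Qed.

Lemma gale_leP n (T S : {set 'I_n}) :
  reflect (#|T| = #|S| /\ forall i, rk S i <= rk T i) (gale_le T S).
Proof.
have srt (U : {set 'I_n}) : sorted leq (sorted_elems U) by apply/sort_sorted/leq_total.
apply: (iffP andP) => -[]; [move/eqP=> card /allP le|move=> card le]; split=> //.
- move=> i; rewrite -!count_sorted_elems.
  case E : (count _ (sorted_elems S)) => [|k] //.
  have kS : k < #|S| by rewrite -size_sorted_elems -E count_size.
  rewrite -nth_lt_count ?size_sorted_elems ?card //.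
  apply: (@leq_ltn_trans (nth 0 (sorted_elems S) k)).
    by apply: le; rewrite mem_iota card.
  by rewrite nth_lt_count ?size_sorted_elems // E.
- by rewrite card.
apply/allP => k; rewrite mem_iota /= add0n => kT.
(* The count inequality is used at the threshold one above the [k]-th element of [S], below which
   [S] has more than [k] elements. *)
rewrite -ltnS nth_lt_count ?size_sorted_elems //.
rewrite count_sorted_elems (leq_trans _ (le _)) // -count_sorted_elems.
by rewrite -nth_lt_count ?size_sorted_elems // -card.
Qed.

Lemma card_rk n (S : {set 'I_n}) : rk S n = #|S|.
Proof.
rewrite psum_oversize // -sum1_card [RHS]big_mkcond.
by apply: eq_bigr => j _; case: ifP.
Qed.

(** * Splitting an integer point into bases *)

Lemma sum_divn_shift t X : 0 < t -> \sum_(0 <= l < t) (X + l) %/ t = X.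
Proof.
move=> t0; elim: X => [|X IH].
  by rewrite big_nat big1 // => l /andP[_ lt]; rewrite divn_small.
(* Splitting off the last term on one side and the first on the other compares the sums for [X] and
   [X.+1]; they differ by [(X + t) %/ t - X %/ t = 1]. *)
have := erefl (\sum_(0 <= l < t.+1) (X + l) %/ t).
rewrite {1}big_nat_recr //= big_nat_recl //= IH divnDr // divnn t0 addn0.
under eq_bigr => l _ do rewrite -addSnnS.
by lia.
Qed.

(* Since [f j <= t], the floor jumps by at most one, and by Hermite's identity
   (sum_divn_shift) each [j] lies in exactly [f j] of the layers [l < t]. *)
Definition layer (t n : nat) (f : 'I_n -> nat) (l : nat) : {set 'I_n} :=
  [set j : 'I_n | (psum n f j + l) %/ t < (psum n f j.+1 + l) %/ t].

Lemma layer_step t n (f : 'I_n -> nat) l (j : 'I_n) :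
  0 < t -> (forall i, f i <= t) ->
  (psum n f j.+1 + l) %/ t = (psum n f j + l) %/ t + (j \in layer t n f l).
Proof.
move=> t_gt0 f_le; rewrite inE psum_succ.
have h1 : (psum n f j + l) %/ t <= (psum n f j + f j + l) %/ t.
  by apply: leq_div2r; lia.
have h2 : (psum n f j + f j + l) %/ t <= ((psum n f j + l) %/ t).+1.
  have -> : ((psum n f j + l) %/ t).+1 = (psum n f j + l + t) %/ t.
    by rewrite [RHS]divnDr // divnn t_gt0 addn1.
  by apply: leq_div2r; have := f_le j; lia.
by case: ltnP; lia.
Qed.

(** The jumps telescope from [l %/ t = 0], which is where [l < t] enters. *)
Lemma rk_layer t n (f : 'I_n -> nat) l i :
  (forall j, f j <= t) -> l < t -> i <= n ->
  rk (layer t n f l) i = (psum n f i + l) %/ t.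
Proof.
move=> f_le lt; elim: i => [|i IH] ni; first by rewrite !psum0 divn_small.
have := layer_step t n f l (Ordinal ni) (leq_ltn_trans (leq0n l) lt) f_le.
rewrite /= => ->.
by rewrite -IH ?(ltnW ni) // (psum_succ n _ (Ordinal ni)).
Qed.

(** The difference of Hermite's identity at two consecutive prefix sums. *)
Lemma sum_layer t n (f : 'I_n -> nat) (j : 'I_n) :
  0 < t -> (forall i, f i <= t) ->
  \sum_(0 <= l < t) (j \in layer t n f l) = f j.
Proof.
move=> t_gt0 f_le; have := sum_divn_shift t (psum n f j.+1) t_gt0.
under eq_bigr => l _ do rewrite (layer_step t n f l j t_gt0 f_le).
by rewrite big_split /= sum_divn_shift // psum_succ => /addnI.
Qed.

(** Dividing [t * rk S i <= psum n f i + l] by [t] gives the prefix-count form of the Gale order; at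
    [i = n], [l < t] makes the quotient exactly the size of [S]. *)
Lemma layer_basis t n (f : 'I_n -> nat) (S : {set 'I_n}) l :
  (forall j, f j <= t) -> l < t ->
  (forall i, t * rk S i <= psum n f i) -> psum n f n = t * rk S n ->
  layer t n f l \in schubert_bases S.
Proof.
move=> f_le lt pre tot; have t_gt0 := leq_ltn_trans (leq0n l) lt.
rewrite inE; apply/gale_leP.
have card : #|layer t n f l| = #|S|.
  by rewrite -!card_rk rk_layer // tot mulnC divnMDl // divn_small // addn0.
split=> // i; case: (leqP i n) => ni; last first.
  by rewrite !psum_oversize ?(ltnW ni) // -!(psum_oversize n _ n) // !card_rk card.
rewrite rk_layer // leq_divRL // mulnC.
by apply: leq_trans (pre i) (leq_addr _ _).
Qed.

(** * Lattice points of the dilated polytope *)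

(** Different [l] may yield the same basis, so bases are weighted by multiplicity; this turns the
    weighted sum over bases into a sum over [l]. *)
Lemma sum_pushforward (R : realType) (I : finType) (A : {set I}) t
    (h : nat -> I) (g : I -> R) :
  (forall l, l < t -> h l \in A) ->
  (\sum_(B in A) (\sum_(0 <= l < t) (h l == B)%:R) * g B = \sum_(0 <= l < t) g (h l))%R.
Proof.
move=> hA; under eq_bigr => B _ do rewrite mulr_suml.
rewrite exchange_big /=; apply: eq_big_nat => l /andP[_ lt].
rewrite (bigD1 (h l)) ?hA //= eqxx mul1r big1 ?addr0 // => B /andP[_ nB].
by rewrite eq_sym (negbTE nB) mul0r.
Qed.

Lemma in_polytope_of_psum (R : realType) t n (S : {set 'I_n}) (f : 'I_n -> nat) :
  0 < t -> (forall j, f j <= t) ->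
  (forall i, t * rk S i <= psum n f i) -> psum n f n = t * rk S n ->
  in_dilated_matroid_polytope R (schubert_bases S) t [ffun j => Posz (f j)].
Proof.
move=> t0 fle pre tot.
have hA l : l < t -> layer t n f l \in schubert_bases S.
  by move=> lt; apply: layer_basis.
have tn0 : (t%:R != 0 :> R)%R by rewrite pnatr_eq0 -lt0n.
(* The weight of [B] is the fraction of the [t] layers equal to [B]. *)
exists (fun B => t%:R^-1 * \sum_(0 <= l < t) (layer t n f l == B)%:R)%R.
split; first by move=> B _; rewrite mulr_ge0 ?invr_ge0 ?ler0n // sumr_ge0.
split.
  under eq_bigr => B _ do rewrite -(mulr1 (_ * _)%R) -mulrA.
  rewrite -mulr_sumr (sum_pushforward _ _ _ _ (layer t n f) (fun=> 1%R)) //.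
  by rewrite big_const_nat subn0 iter_addr_0 mulVf.
move=> j; rewrite ffunE.
under eq_bigr => B _ do rewrite -mulrA.
rewrite -mulr_sumr (sum_pushforward _ _ _ _ (layer t n f) (fun B => (j \in B)%:R)%R) //.
by rewrite mulVKf // -natr_sum sum_layer.
Qed.

(** Each condition is linear and holds at every basis, so it survives convex combination and scaling
    by [t]. Absolute values only convert to [nat], as the coordinates are nonnegative. *)
Lemma psum_of_in_polytope (R : realType) t n (S : {set 'I_n}) (x : {ffun 'I_n -> int}) :
  in_dilated_matroid_polytope R (schubert_bases S) t x ->
  [/\ forall j, (0 <= x j <= Posz t)%R,
      forall i, t * rk S i <= psum n (fun j => `|x j|%N) i &
      psum n (fun j => `|x j|%N) n = t * rk S n].
Proof.
case=> lam [lam0 [lam1 xE]].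
have x0 j : (0 <= x j)%R.
  rewrite -(ler0z R) xE mulr_ge0 // sumr_ge0 // => B /lam0 hB.
  by rewrite mulr_ge0.
have pE i : ((psum n (fun j => `|x j|%N) i)%:R =
    t%:R * \sum_(B in schubert_bases S) lam B * (rk B i)%:R :> R)%R.
  rewrite /psum natr_sum.
  under eq_bigr => j _ do rewrite natr_absz ger0_norm // xE.
  rewrite -mulr_sumr exchange_big; congr (_ * _)%R; apply: eq_bigr => B _.
  by rewrite natr_sum mulr_sumr.
split.
- move=> j; rewrite x0 /= -(ler_int R) xE.
  (* The bound 1 is written as the sum of the weights, to compare term by term. *)
  rewrite -[X in (_ <= X)%R]mulr1 -[X in (_ <= _ * X)%R]lam1 ler_wpM2l //.
  apply: ler_sum => B /lam0 hB; by rewrite ler_piMr // lern1 leq_b1.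
- move=> i; rewrite -(ler_nat R) pE natrM ler_wpM2l //.
  rewrite -[X in (X <= _)%R]mul1r -[X in (X * _ <= _)%R]lam1 mulr_suml; apply: ler_sum => B hB.
  rewrite ler_wpM2l ?lam0 // ler_nat.
  by move: hB; rewrite inE => /gale_leP[].
- apply/eqP; rewrite -(eqr_nat R) pE natrM; apply/eqP.
  rewrite -[X in (_ = _ * X)%R]mul1r -[X in (_ = _ * (X * _))%R]lam1 mulr_suml.
  congr (_ * _)%R; apply: eq_bigr => B.
  by rewrite inE => /gale_leP[card _]; rewrite !card_rk card.
Qed.

(** From height 0 the walk conditions are exactly the inequalities of the polytope, and [F] reads a
    word as a coordinate vector. *)
Lemma lattice_point_count_walks (R : realType) n (S : {set 'I_n}) t : 0 < t ->
  lattice_point_count R (schubert_bases S) t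
    (nwalks t [seq j \in S | j <- enum 'I_n] 0).
Proof.
move=> t0; set bits := map _ _.
have szb : size bits = n by rewrite size_map size_enum_ord.
have totb : count id bits = rk S n.
  by rewrite -count_take_enum take_oversize // szb.
pose F (w : seq nat) : {ffun 'I_n -> int} := [ffun j : 'I_n => Posz (nth 0 w j)].
have wE (w : seq nat) : size w = n -> w = [seq nth 0 w (val j) | j <- enum 'I_n].
  by move=> sz; rewrite (map_comp (nth 0 w) val) val_enum_ord -sz map_nth_iota0 // take_size.
exists (map F (walks t 0 bits)); split; last split; last by rewrite size_map.
  (* [F] pads short words with 0, so injectivity needs the common length [n]. *)
  rewrite map_inj_in_uniq ?walks_uniq // => w w' /mem_walks[sz _ _ _] /mem_walks[sz' _ _ _].
  move=> /ffunP FF; apply: (@eq_from_nth _ 0); first by rewrite sz.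
  move=> i; rewrite sz szb => ni; have := FF (Ordinal ni).
  by rewrite !ffunE => -[].
move=> x; split.
  case/mapP => w /mem_walks[]; rewrite szb totb => sz /all_nthP al pre tot ->.
  have tk i : sumn (take i w) = psum n (fun j => nth 0 w j) i.
    by rewrite {1}(wE w sz) sumn_take_enum.
  apply: in_polytope_of_psum => // [j|i|].
  - by apply: al; rewrite sz.
  - by have := pre i; rewrite tk count_take_enum add0r lez_nat.
  - by rewrite -tk take_oversize ?sz //; move: tot; rewrite add0r => -[].
move=> /psum_of_in_polytope[x0t pre tot].
pose w := [seq `|x j|%N | j <- enum 'I_n].
have tk i : sumn (take i w) = psum n (fun j => `|x j|%N) i by rewrite sumn_take_enum.
have sz : size w = n by rewrite size_map size_enum_ord.
apply/mapP; exists w; last first.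
  apply/ffunP => j; rewrite ffunE (nth_map j) ?size_enum_ord // nth_ord_enum.
  by rewrite gez0_abs //; case/andP: (x0t j).
apply/mem_walks; rewrite szb totb sz; split=> //.
- by apply/allP => y /mapP[j _ ->]; rewrite -lez_nat gez0_abs; case/andP: (x0t j).
- by move=> i; rewrite add0r lez_nat count_take_enum tk; apply: pre.
- by rewrite add0r -tot -tk take_oversize ?sz.
Qed.

(* r is 1-indexed: r(S) = (r 1, ..., r (2m)).  Element i : 'I_n stands for i+1;
   a vector c = (c_1,...,c_m) is the list c with c_j = nth 0 c (j-1). *)
Theorem theorem1p1 (R : realType) (n : nat) (S : {set 'I_n}) (m : nat)
    (r : nat -> nat) (t : nat) :
  1 <= n ->
  (forall i : 'I_n, i.+1 = n -> i \in S) ->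
  (forall k, 2 <= k <= 2 * m -> 0 < r k) ->
  [seq i \in S | i <- enum 'I_n] =
    flatten [seq nseq (r k) (~~ odd k) | k <- iota 1 (2 * m)] ->
  0 < t ->
  let u := fun i => minn (r (2 * i - 1)) (\sum_(i + 1 <= j < m + 1) r (2 * j)) in
  let v := fun i => minn (r (2 * i)) (\sum_(1 <= j < i) r (2 * j - 1)) in
  lattice_point_count R (schubert_bases S) t
    (\sum_(c <- box [seq ((- Posz (t * v j))%R, Posz (t * u j)) | j <- iota 1 m]
         | (\sum_(x <- c) x == 0)%R &&
           all (fun j => (0 <= \sum_(x <- take j c) x)%R) (iota 1 m))
         \prod_(j < m) Ffun (r (2 * j).+1)%N (r (2 * j.+1))%N (nth 0%R c j) t)%R.
Proof.
move=> _ _ rpos runs t0 u v.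
by rewrite schubert_sum_nwalks // -runs; apply: lattice_point_count_walks.
Qed.
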